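(* Let $o\in\{1,\dots,n\}$, let $n^+(\cdot)$ denote the number of positive components of a vector, and let $\bar\Omega_o=\Omega_o\setminus\left\{\begin{pmatrix}\mathbf{x}_o\\ \mathbf{y}_o\end{pmatrix}\right\}$. In (iii)–(viii), elements of $\bar\Omega_o$ are written $\begin{pmatrix}\mathbf{x}_o-\mathbf{s}^-\\ \mathbf{y}_o+\mathbf{s}^+\end{pmatrix}$. Then: (i) $(\mathbf{x}_o,\mathbf{y}_o)\in E$ if and only if $\Omega_o=\varnothing$. (ii) $(\mathbf{x}_o,\mathbf{y}_o)\in E'$ if and only if $\Omega_o\neq\varnothing$ and $\bar\Omega_o=\varnothing$. (iii) $(\mathbf{x}_o,\mathbf{y}_o)\in WE_I$ if and only if $\bar\Omega_o\ne\varnothing$ and $n^+(\mathbf{s}^-)<n^+(\mathbf{x}_o)$ for all $\begin{pmatrix}\mathbf{x}_o-\mathbf{s}^-\\ \mathbf{y}_o+\mathbf{s}^+\end{pmatrix}\in\bar\Omega_o$. (iv) $(\mathbf{x}_o,\mathbf{y}_o)\in NE_I$ if and only if $\bar\Omega_o\ne\varnothing$ and $n^+(\mathbf{s}^-)=n^+(\mathbf{x}_o)$ for some $\begin{pmatrix}\mathbf{x}_o-\mathbf{s}^-\\ \mathbf{y}_o+\mathbf{s}^+\end{pmatrix}\in\bar\Omega_o$. (v) $(\mathbf{x}_o,\mathbf{y}_o)\in WE_O$ if and only if $\bar\Omega_o\ne\varnothing$ and $n^+(\mathbf{s}^+)<n^+(\mathbf{y}_o)$ for all $\begin{pmatrix}\mathbf{x}_o-\mathbf{s}^-\\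 \mathbf{y}_o+\mathbf{s}^+\end{pmatrix}\in\bar\Omega_o$. (vi) $(\mathbf{x}_o,\mathbf{y}_o)\in NE_O$ if and only if $\bar\Omega_o\ne\varnothing$ and $n^+(\mathbf{s}^+)=n^+(\mathbf{y}_o)$ for some $\begin{pmatrix}\mathbf{x}_o-\mathbf{s}^-\\ \mathbf{y}_o+\mathbf{s}^+\end{pmatrix}\in\bar\Omega_o$. (vii) $(\mathbf{x}_o,\mathbf{y}_o)\in WE_P$ if and only if $\bar\Omega_o\ne\varnothing$ and $n^+(\mathbf{s}^-)+n^+(\mathbf{s}^+)<m+s$ for all $\begin{pmatrix}\mathbf{x}_o-\mathbf{s}^-\\ \mathbf{y}_o+\mathbf{s}^+\end{pmatrix}\in\bar\Omega_o$. (viii) $(\mathbf{x}_o,\mathbf{y}_o)\in NE_P$ if and only if $\bar\Omega_o\ne\varnothing$ and $n^+(\mathbf{s}^-)+n^+(\mathbf{s}^+)=m+s$ for some $\begin{pmatrix}\mathbf{x}_o-\mathbf{s}^-\\ \mathbf{y}_o+\mathbf{s}^+\end{pmatrix}\in\bar\Omega_o$.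
   Context: There are $n$ observed decision making units; $\mathrm{DMU}_j$ has input vector $\mathbf{x}_j\in\mathbb{R}_+^m$ and output vector $\mathbf{y}_j\in\mathbb{R}_+^s$ (nonnegative entries). $\mathbf{X}=[\mathbf{x}_1\ \dots\ \mathbf{x}_n]$, $\mathbf{Y}=[\mathbf{y}_1\ \dots\ \mathbf{y}_n]$; $\mathbf{X}_o,\mathbf{Y}_o$ are obtained from them by deleting the columns $\mathbf{x}_o$, $\mathbf{y}_o$. For vectors, $\mathbf{u}\geqq\mathbf{v}$ means $u_j\ge v_j$ for all $j$; $\mathbf{u}\geq\mathbf{v}$ means $\mathbf{u}\geqq\mathbf{v}$ and $\mathbf{u}\ne\mathbf{v}$; $\mathbf{u}>\mathbf{v}$ means $u_j>v_j$ for all $j$. $\mathbf{1}_d,\mathbf{0}_d$ are the all-ones and all-zeros vectors in $\mathbb{R}^d$. $T^{DEA}=\{(\mathbf{x},\mathbf{y})\in\mathbb{R}_+^m\times\mathbb{R}_+^s \mid \mathbf{x}\geqq\mathbf{X}\boldsymbol{\lambda},\ \mathbf{Y}\boldsymbol{\lambda}\geqq\mathbf{y},\ \mathbf{1}_n^T\boldsymbol{\lambda}=1,\ \boldsymbol{\lambda}\geqq\mathbf{0}_n\text{ for some }\boldsymbol{\lambda}\}$. $\Omega_o$ is the set of activities that dominate $\mathrm{DMU}_o$ in the technology generated by the remaining DMUs: the set of all vectors $\begin{pmatrix}\mathbf{x}_o-\mathbf{s}^-\\ \mathbf{y}_o+\mathbf{s}^+\end{pmatrix}$ with $\mathbf{s}^-\geqq\mathbf{0}_m$,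 $\mathbf{s}^+\geqq\mathbf{0}_s$ for which there is $\boldsymbol{\mu}\geqq\mathbf{0}_{n-1}$ with $\mathbf{x}_o\geqq\mathbf{X}_o\boldsymbol{\mu}+\mathbf{s}^-$, $\mathbf{Y}_o\boldsymbol{\mu}-\mathbf{s}^+\geqq\mathbf{y}_o$, $\mathbf{1}_{n-1}^T\boldsymbol{\mu}=1$. Input-oriented BCC model for $\mathrm{DMU}_o$: $\min\ \theta-\varepsilon(\mathbf{1}_m^T\mathbf{s}^-+\mathbf{1}_s^T\mathbf{s}^+)$ subject to $-\mathbf{X}\boldsymbol{\lambda}-\mathbf{s}^-\geqq-\theta\mathbf{x}_o$, $\mathbf{Y}\boldsymbol{\lambda}-\mathbf{s}^+\geqq\mathbf{y}_o$, $\mathbf{1}_n^T\boldsymbol{\lambda}=1$, $\boldsymbol{\lambda}\geqq\mathbf{0}_n$, $\mathbf{s}^-\geqq\mathbf{0}_m$, $\mathbf{s}^+\geqq\mathbf{0}_s$ ($\varepsilon>0$ non-Archimedean infinitesimal, i.e. first minimize $\theta$ to get $\theta^*$, then fix $\theta=\theta^*$ and maximize the sum of slacks). The definitions below refer to an optimal solution $(\theta^*,\boldsymbol{\lambda}^*,\mathbf{s}^{-*},\mathbf{s}^{+*})$ (whose existence is presupposed). $\mathrm{DMU}_o$ is BCC inefficient iff $\theta^*<1$; weakly BCC efficient iff $\theta^*=1$; strongly BCC efficient iff $\theta^*=1$, $\mathbf{s}^{-*}=\mathbf{0}_m$, $\mathbf{s}^{+*}=\mathbf{0}_s$. Output-oriented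 notions are defined analogously from the output-oriented BCC model, $\max\ \varphi+\varepsilon(\mathbf{1}_m^T\mathbf{s}^-+\mathbf{1}_s^T\mathbf{s}^+)$ subject to $\mathbf{X}\boldsymbol{\lambda}+\mathbf{s}^-\leqq\mathbf{x}_o$, $\mathbf{Y}\boldsymbol{\lambda}-\mathbf{s}^+\geqq\varphi\mathbf{y}_o$, $\mathbf{1}_n^T\boldsymbol{\lambda}=1$, $\boldsymbol{\lambda}\geqq\mathbf{0}_n$, $\mathbf{s}^-\geqq\mathbf{0}_m$, $\mathbf{s}^+\geqq\mathbf{0}_s$: inefficient iff $\varphi^*>1$; weakly efficient iff $\varphi^*=1$; strongly efficient iff $\varphi^*=1$ and the optimal slacks vanish. Pareto efficiency: $(\mathbf{x}',\mathbf{y}')$ dominates (resp. strongly dominates) $(\mathbf{x},\mathbf{y})$ iff $\begin{pmatrix}-\mathbf{x}'\\ \mathbf{y}'\end{pmatrix}\geq\begin{pmatrix}-\mathbf{x}\\ \mathbf{y}\end{pmatrix}$ (resp. $>$). $\mathrm{DMU}_o$ is Pareto inefficient iff some $(\mathbf{x},\mathbf{y})\in T^{DEA}$ strongly dominates $(\mathbf{x}_o,\mathbf{y}_o)$; weakly Pareto efficient iff none does; strongly Pareto efficient iff no $(\mathbf{x},\mathbf{y})\in T^{DEA}$ dominates it. Strong BCC and strong Pareto efficiency are equivalent. Classes of observed DMUs: $E$ (extreme efficient) = strongly efficient DMUs that cannot be represented as a convex combination of the remaining DMUs; $E'$ (non-extreme efficient) = strongly efficient DMUs that can be so represented; $WE_I$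 (resp. $WE_O$) = DMUs that are weakly but not strongly BCC efficient in the input (resp. output) orientation; $NE_I$ (resp. $NE_O$) = DMUs that are BCC inefficient in the input (resp. output) orientation; $WE_P$ = weakly but not strongly Pareto efficient DMUs; $NE_P$ = Pareto inefficient DMUs.
   Formalization: In (v) the left-to-right direction and in (vi) the right-to-left direction are stated only for y_o > 0 (all outputs of DMU_o positive), since both fail when y_o has a zero entry; (i)–(vi) presuppose an optimal solution of the BCC model used, and m, s ≥ 1. *)

(* Defs.v *)
From mathcomp Require Import all_boot all_order all_algebra.
From mathcomp Require Import all_classical all_reals.

Set Implicit Arguments.
Unset Strict Implicit.
Unset Printing Implicit Defensive.

Import Order.TTheory GRing.Theory Num.Theory.
Local Open Scope classical_set_scope.
Local Open Scope ring_scope.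

Section Vectors.
Context {R : realType} {d : nat}.
Implicit Types u v : 'cV[R]_d.

Definition vle u v := forall i, u i 0 <= v i 0.

Definition vlt u v := forall i, u i 0 < v i 0.

Definition vsum v : R := \sum_i v i 0.

Definition npos v : nat := #|[pred i | 0 < v i 0]|.

End Vectors.

Section DEA.
Context {R : realType} {m s n : nat}.
Variables (X : 'M[R]_(m, n)) (Y : 'M[R]_(s, n)).
Implicit Types (o : 'I_n).

Definition TDEA : set ('cV[R]_m * 'cV[R]_s) :=
  [set a | [/\ vle 0 a.1, vle 0 a.2 &
     exists lam : 'cV[R]_n,
       [/\ vle (X *m lam) a.1, vle a.2 (Y *m lam), vsum lam = 1 & vle 0 lam]]].

Definition shifted o (sm : 'cV[R]_m) (sp : 'cV[R]_s) : 'cV[R]_(m + s) :=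
  col_mx (col o X - sm) (col o Y + sp).

(* [col' o X] is X without its o-th column, so mu has n.-1 entries. *)
Definition Omega o : set 'cV[R]_(m + s) :=
  [set w | exists sm sp, [/\ w = shifted o sm sp, vle 0 sm, vle 0 sp &
     exists mu : 'cV[R]_n.-1,
       [/\ vle 0 mu, vle (col' o X *m mu + sm) (col o X),
           vle (col o Y) (col' o Y *m mu - sp) & vsum mu = 1]]].

Definition Omega_bar o : set 'cV[R]_(m + s) :=
  Omega o `\ col_mx (col o X) (col o Y).

(* A point of either BCC model; [factor] is theta or phi. *)
Record bcc_point := BccPoint {
  factor : R;
  weights : 'cV[R]_n;
  input_slack : 'cV[R]_m;
  output_slack : 'cV[R]_s }.
Implicit Types z : bcc_point.

Definition total_slack z : R := vsum (input_slack z) + vsum (output_slack z).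

(* The factor is sign-free, as in the models. *)
Definition input_feasible o z : Prop :=
  [/\ vle (- (factor z *: col o X)) (- (X *m weights z) - input_slack z),
      vle (col o Y) (Y *m weights z - output_slack z),
      vsum (weights z) = 1, vle 0 (weights z) &
      vle 0 (input_slack z) /\ vle 0 (output_slack z)].

Definition output_feasible o z : Prop :=
  [/\ vle (X *m weights z + input_slack z) (col o X),
      vle (factor z *: col o Y) (Y *m weights z - output_slack z),
      vsum (weights z) = 1, vle 0 (weights z) &
      vle 0 (input_slack z) /\ vle 0 (output_slack z)].

(* The infinitesimal epsilon is rendered by two-stage optimality: first the
   factor, then the total slack among the points with the optimal factor. *)
Definition input_optimal o z : Prop :=
  [/\ input_feasible o z,
      forall z', input_feasible o z' -> factor z <= factor z' &
      forall z', input_feasible o z' -> factor z' = factor z ->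
        total_slack z' <= total_slack z].

Definition output_optimal o z : Prop :=
  [/\ output_feasible o z,
      forall z', output_feasible o z' -> factor z' <= factor z &
      forall z', output_feasible o z' -> factor z' = factor z ->
        total_slack z' <= total_slack z].

Definition input_solvable o := exists z, input_optimal o z.
Definition output_solvable o := exists z, output_optimal o z.

Definition inefficient_I o := exists z, input_optimal o z /\ factor z < 1.
Definition weakly_efficient_I o := exists z, input_optimal o z /\ factor z = 1.
Definition strongly_efficient_I o := exists z,
  [/\ input_optimal o z, factor z = 1, input_slack z = 0 & output_slack z = 0].

Definition inefficient_O o := exists z, output_optimal o z /\ 1 < factor z.
Definition weakly_efficient_O o := exists z, output_optimal o z /\ factor z = 1.
Definition strongly_efficient_O o := exists z,
  [/\ output_optimal o z, factor z = 1, input_slack z = 0 & output_slack z = 0].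

Definition dominates (a' a : 'cV[R]_m * 'cV[R]_s) :=
  vle (col_mx (- a.1) a.2) (col_mx (- a'.1) a'.2) /\
  col_mx (- a'.1) a'.2 <> col_mx (- a.1) a.2.
Definition strongly_dominates (a' a : 'cV[R]_m * 'cV[R]_s) :=
  vlt (col_mx (- a.1) a.2) (col_mx (- a'.1) a'.2).

Definition inefficient_P o :=
  exists a, TDEA a /\ strongly_dominates a (col o X, col o Y).
Definition weakly_efficient_P o :=
  ~ exists a, TDEA a /\ strongly_dominates a (col o X, col o Y).
Definition strongly_efficient_P o :=
  ~ exists a, TDEA a /\ dominates a (col o X, col o Y).

(* Strong efficiency in the BCC and in the Pareto sense agree when the BCC
   models have optimal solutions; the classes E and E' are indexed by the
   sense that is meant. *)
Variant sense := BCC_input | BCC_output | Pareto.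

(* The BCC notions presuppose an optimal solution: the input (output) model is
   unbounded when the input (output) vector of the unit is zero. *)
Definition meaningful (k : sense) o : Prop :=
  match k with
  | BCC_input => input_solvable o
  | BCC_output => output_solvable o
  | Pareto => True
  end.

Definition strongly_efficient (k : sense) : 'I_n -> Prop :=
  match k with
  | BCC_input => strongly_efficient_I
  | BCC_output => strongly_efficient_O
  | Pareto => strongly_efficient_P
  end.

Definition combination_of_others o := exists mu : 'cV[R]_n.-1,
  [/\ vle 0 mu, vsum mu = 1, col o X = col' o X *m mu &
      col o Y = col' o Y *m mu].

Definition E (k : sense) : set 'I_n :=
  [set o | strongly_efficient k o /\ ~ combination_of_others o].
Definition E' (k : sense) : set 'I_n :=
  [set o | strongly_efficient k o /\ combination_of_others o].

Definition WE_I : set 'I_n :=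
  [set o | weakly_efficient_I o /\ ~ strongly_efficient_I o].
Definition WE_O : set 'I_n :=
  [set o | weakly_efficient_O o /\ ~ strongly_efficient_O o].
Definition WE_P : set 'I_n :=
  [set o | weakly_efficient_P o /\ ~ strongly_efficient_P o].

Definition NE_I : set 'I_n := [set o | inefficient_I o].
Definition NE_O : set 'I_n := [set o | inefficient_O o].
Definition NE_P : set 'I_n := [set o | inefficient_P o].

End DEA.

(* Main.v *)
(** Scaling away the weight that a convex combination gives to [DMU_o] itself
    shows that the points of [Omega_bar o] are exactly the nonzero slack pairs
    that are feasible over all the DMUs. Such a pair realises a factor
    [theta < 1] precisely when the input slack is positive wherever [x_o] is,
    since a small multiple of [x_o] then fits below it; likewise for [phi > 1]
    with a positive [y_o], and for strong dominance with all coordinates. *)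

Require Import Defs.
From mathcomp Require Import all_boot all_order all_algebra.
From mathcomp Require Import all_classical all_reals.
From mathcomp Require Import lra zify.

Import Order.TTheory GRing.Theory Num.Theory.
Local Open Scope classical_set_scope.
Local Open Scope ring_scope.

(** * Supports and scaling of nonnegative vectors *)

Section Vectors.
Context {R : realType} {d : nat}.
Implicit Types u v : 'cV[R]_d.

Lemma vle0P v : vle 0 v <-> forall i, 0 <= v i 0.
Proof. by split=> h i; have := h i; rewrite mxE. Qed.

Lemma vle_anti0 v : vle 0 v -> (forall i, v i 0 <= 0) -> v = 0.
Proof.
move=> /vle0P v0 h; apply/colP => i; rewrite mxE; apply/le_anti.
by rewrite h v0.
Qed.

Lemma vsum_ge0 v : vle 0 v -> 0 <= vsum v.
Proof. by move=> /vle0P v0; apply: sumr_ge0. Qed.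

Lemma vsum_eq0 v : vle 0 v -> vsum v <= 0 -> v = 0.
Proof.
move=> v0 sv; have /eqP s0 : vsum v == 0 by rewrite eq_le sv vsum_ge0.
move/vle0P in v0; apply/colP => i; rewrite mxE.
exact: (psumr_eq0P (fun i _ => v0 i) s0).
Qed.

Lemma npos_le u v : (forall i, 0 < u i 0 -> 0 < v i 0) -> (npos u <= npos v)%N.
Proof. by move=> uv; apply/subset_leq_card/fintype.subsetP => i; exact: uv. Qed.

Lemma npos_eq u v : (forall i, 0 < u i 0 -> 0 < v i 0) -> npos u = npos v ->
  forall i, 0 < v i 0 -> 0 < u i 0.
Proof.
move=> uv /subset_cardP e i vi.
have sub : [pred i | 0 < u i 0] \subset [pred i | 0 < v i 0].
  by apply/fintype.subsetP => j; exact: uv.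
by have := e sub i; rewrite !inE vi.
Qed.

Lemma npos_max v : (npos v <= d)%N.
Proof. by rewrite -[leqRHS]card_ord max_card. Qed.

Lemma npos_full v : npos v = d <-> vlt 0 v.
Proof.
split=> [e i | v0].
  have /subset_cardP : npos v = #|'I_d| by rewrite card_ord.
  move=> /(_ (subset_predT _)) /(_ i); rewrite !inE => vi.
  by rewrite mxE vi.
rewrite /npos -[RHS]card_ord; apply: eq_card => i; rewrite !inE.
by have := v0 i; rewrite mxE.
Qed.

(** The scale must not exceed any ratio [u i 0 / v i 0]. The inverse of one plus the sum of all
    [v i 0 / u i 0] works: the sum bounds each term, and the one keeps it invertible. *)
Lemma scale_below u v : vle 0 u -> vle 0 v ->
  (forall i, 0 < v i 0 -> 0 < u i 0) -> exists2 e, 0 < e & vle (e *: v) u.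
Proof.
move=> /vle0P u0 /vle0P v0 uv.
(* The quotient is [0] when [u i 0 = 0], in which case [v i 0 = 0] as well. *)
pose q i := v i 0 / u i 0; have q0 i : 0 <= q i by rewrite divr_ge0.
have S0 : 0 <= \sum_i q i by apply: sumr_ge0.
have S1 : 0 < 1 + \sum_i q i by lra.
exists (1 + \sum_i q i)^-1 => [|i]; first by rewrite invr_gt0.
rewrite mxE mulrC ler_pdivrMr //.
have [ui|ui] := ltP 0 (u i 0); last first.
  have -> : v i 0 = 0.
    apply/le_anti; rewrite v0 andbT leNgt; apply/negP => /uv; lra.
  by rewrite mulr_ge0 // ltW.
rewrite mulrC -ler_pdivrMr // -/(q i) (bigD1 i) //=.
suff : 0 <= \sum_(j | j != i) q j by lra.
exact: sumr_ge0.
Qed.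

End Vectors.

(** * Splitting off, and padding with zero, the weight of one unit *)

Section DeleteOne.
Context {R : realType} {n : nat} (o : 'I_n).

Lemma mulmx_split {p} (A : 'M[R]_(p, n)) (lam : 'cV[R]_n) :
  A *m lam = lam o 0 *: col o A + col' o A *m row' o lam.
Proof.
apply/colP => i; rewrite !mxE (@bigD1_ord _ _ _ _ o) //= mulrC; congr (_ + _).
by apply: eq_bigr => k _; rewrite !mxE.
Qed.

Lemma vsum_split (lam : 'cV[R]_n) : vsum lam = lam o 0 + vsum (row' o lam).
Proof.
rewrite /vsum (@bigD1_ord _ _ _ _ o) //=; congr (_ + _).
by apply: eq_bigr => k _; rewrite !mxE.
Qed.

Definition extend0 (mu : 'cV[R]_n.-1) : 'cV[R]_n :=
  \col_j oapp (fun k => mu k 0) 0 (unlift o j).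

Lemma extend0_o mu : extend0 mu o 0 = 0.
Proof. by rewrite mxE unlift_none. Qed.

Lemma row'_extend0 mu : row' o (extend0 mu) = mu.
Proof. by apply/colP => k; rewrite !mxE liftK. Qed.

Lemma extend0_ge0 mu : vle 0 mu -> vle 0 (extend0 mu).
Proof.
by move=> /vle0P mu0; apply/vle0P => j; rewrite mxE; case: unlift => /=.
Qed.

End DeleteOne.

(** * Slack pairs over all units and their relation to [Omega_bar] *)

Section Slacks.
Context {R : realType} {m s n : nat}.
Context {X : 'M[R]_(m, n)} {Y : 'M[R]_(s, n)} {o : 'I_n}.
Hypotheses (X_ge0 : forall i j, 0 <= X i j) (Y_ge0 : forall r j, 0 <= Y r j).

Let x := col o X.
Let y := col o Y.

(** The condition defining [Omega], but with the unit [o] allowed among its own references. All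
    notions of efficiency are compared through it. *)
Definition slack_pair (sm : 'cV[R]_m) (sp : 'cV[R]_s) :=
  [/\ vle 0 sm, vle 0 sp & exists lam : 'cV[R]_n,
    [/\ vle 0 lam, vsum lam = 1, vle (X *m lam + sm) x &
        vle y (Y *m lam - sp)]].

Let x_ge0 i : 0 <= x i 0. Proof. by rewrite mxE. Qed.
Let y_ge0 i : 0 <= y i 0. Proof. by rewrite mxE. Qed.

Lemma Xlam_ge0 lam i : vle 0 lam -> 0 <= (X *m lam) i 0.
Proof.
move=> /vle0P lam0; rewrite mxE; apply: sumr_ge0 => j _.
by rewrite mulr_ge0.
Qed.

Lemma shifted_inj sm sp sm' sp' :
  shifted X Y o sm sp = shifted X Y o sm' sp' -> sm = sm' /\ sp = sp'.
Proof.
by move=> /eq_col_mx [/addrI /oppr_inj -> /addrI ->].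
Qed.

Lemma shifted0 : shifted X Y o 0 0 = col_mx x y.
Proof. by rewrite /shifted subr0 addr0. Qed.

Lemma slack_pair0 : slack_pair 0 0.
Proof.
split; try by move=> i; rewrite mxE.
exists (delta_mx o 0); split.
- by move=> i; rewrite !mxE; case: eqP.
- rewrite /vsum (bigD1 o) //= mxE !eqxx big1 ?addr0 // => i /negPf io.
  by rewrite mxE io.
- by rewrite -colE addr0 => i.
- by rewrite -colE subr0 => i.
Qed.

Lemma Omega_bar_shifted sm sp :
  Omega_bar X Y o (shifted X Y o sm sp) <->
  slack_pair sm sp /\ ~ (sm = 0 /\ sp = 0).
Proof.
split=> [[[sm' [sp' [e sm0 sp0 [mu [mu0 hX hY mu1]]]]] ne] | [hsp ne]].
  have [-> ->] := shifted_inj _ _ _ _ e; split; last first.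
    move=> [e1 e2]; apply: ne; rewrite /= e e1 e2; exact: shifted0.
  (* Weights on the other units become weights on all units by giving [o] weight zero. *)
  split=> //; exists (extend0 o mu).
  rewrite (vsum_split o) !(mulmx_split o) !extend0_o !row'_extend0 add0r.
  by rewrite !scale0r !add0r; split=> //; exact: extend0_ge0.
split; last by rewrite /= -shifted0 => /shifted_inj.
case: hsp => sm0 sp0 [lam [lam0 lam1 hX hY]].
exists sm, sp; split=> //; set t := lam o 0.
have t0 : 0 <= t by move/vle0P: lam0; exact.
have r0 : vle 0 (row' o lam).
  by apply/vle0P => k; rewrite mxE; move/vle0P: lam0; exact.
have := vsum_split o lam; rewrite lam1 -/t => e1.
have rs0 := vsum_ge0 _ r0.
move: hX hY; rewrite !(mulmx_split o) -/t => hX hY.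
(* If [o] carries the whole weight, it is compared with itself alone and both slacks vanish, which
   [ne] excludes. Otherwise the remaining weights are normalised by [1 - t]. *)
have [t1|t1] := leP 1 t.
  have t_eq : t = 1 by lra.
  have rl : row' o lam = 0 by apply: vsum_eq0 => //; lra.
  case: ne; move: hX hY; rewrite rl !mulmx0 !addr0 t_eq !scale1r => hX hY.
  split; apply: vle_anti0 => // i.
    by have := hX i; rewrite !mxE; lra.
  by have := hY i; rewrite !mxE; lra.
have c0 : 0 < 1 - t by lra.
have cn : 1 - t != 0 by rewrite gt_eqF.
pose mu := (1 - t)^-1 *: row' o lam.
have rE : row' o lam = (1 - t) *: mu by rewrite scalerA mulfV // scale1r.
move: mu rE => mu rE; exists mu; split.
- apply/vle0P => k; move/vle0P: r0 => /(_ k).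
  by rewrite rE mxE pmulr_rge0.
- move=> i; have := hX i; rewrite rE -scalemxAr !mxE => h.
  have sm0i : 0 <= sm i 0 by move/vle0P: sm0.
  (* After multiplication by [1 - t] the goal asks only for the slack [(1 - t) * sm i 0], while [h]
     provides all of [sm i 0]; [ts] is the difference. *)
  have ts := mulr_ge0 t0 sm0i; rewrite -(ler_pM2l c0); nra.
- move=> i; have := hY i; rewrite rE -scalemxAr !mxE => h.
  have sp0i : 0 <= sp i 0 by move/vle0P: sp0.
  have ts := mulr_ge0 t0 sp0i; rewrite -(ler_pM2l c0); nra.
- apply: (mulfI cn); rewrite mulr1 {1}/vsum mulr_sumr.
  have -> : \sum_i (1 - t) * mu i 0 = vsum (row' o lam).
    by rewrite rE; apply: eq_bigr => k _; rewrite [in RHS]mxE.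
  lra.
Qed.

Lemma Omega_bar0P :
  Omega_bar X Y o = set0 <->
  forall sm sp, slack_pair sm sp -> sm = 0 /\ sp = 0.
Proof.
split=> [e sm sp h | h].
  apply: contrapT => ne; suff : set0 (shifted X Y o sm sp) by [].
  by rewrite -e; apply/Omega_bar_shifted.
apply/eqP; apply/negPn/negP => /set0P [w hw].
have [[sm [sp [e _ _ _]]] _] := hw.
by move: hw; rewrite e => /Omega_bar_shifted [/h].
Qed.

Lemma Omega_barN0 sm sp :
  Omega_bar X Y o (shifted X Y o sm sp) -> Omega_bar X Y o !=set0.
Proof. by move=> h; exists (shifted X Y o sm sp). Qed.

Lemma combination_of_others_Omega :
  combination_of_others X Y o -> Omega X Y o !=set0.
Proof.
move=> [mu [mu0 mu1 eX eY]]; exists (shifted X Y o 0 0), 0, 0; split=> //.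
exists mu; split=> //.
  by rewrite addr0 -eX => i.
by rewrite subr0 -eY => i.
Qed.

Lemma Omega_combination_of_others : Omega_bar X Y o = set0 ->
  Omega X Y o !=set0 -> combination_of_others X Y o.
Proof.
move=> e [w [sm [sp [ew sm0 sp0 [mu [mu0 hX hY mu1]]]]]].
(* The given slacks may fall short of the actual gaps, so the full gaps are taken. They form a slack
   pair, and their vanishing says that [mu] reproduces the unit exactly. *)
pose sm' := x - col' o X *m mu; pose sp' := col' o Y *m mu - y.
have [/subr0_eq eX /subr0_eq eY] : sm' = 0 /\ sp' = 0; last by exists mu.
move/Omega_bar0P : e; apply.
split.
- apply/vle0P => i; have := hX i; have /vle0P/(_ i) := sm0.
  by rewrite /sm' !mxE; lra.
- apply/vle0P => i; have := hY i; have /vle0P/(_ i) := sp0.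
  by rewrite /sp' !mxE; lra.
exists (extend0 o mu).
rewrite (vsum_split o) !(mulmx_split o) !extend0_o !row'_extend0 add0r.
rewrite !scale0r !add0r /sm' /sp' addrC subrK opprB addrC subrK.
by split=> //; exact: extend0_ge0.
Qed.

(** * The BCC models in terms of slack pairs *)

Lemma slack_pair_npos sm sp i : slack_pair sm sp -> 0 < sm i 0 -> 0 < x i 0.
Proof.
(* Nonnegative data give [0 <= X *m lam], hence [sm <= x] entrywise. Outputs have no such bound: an
   output slack may be positive where [y] vanishes. *)
move=> [sm0 _ [lam [lam0 _ hX _]]]; have := hX i.
by rewrite [in X in X -> _]mxE; have := Xlam_ge0 _ i lam0; lra.
Qed.

(** Contracting the inputs by [th] amounts to an additional input slack [(1 - th) *: x], nonnegative
    because [th <= 1]. *)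
Lemma input_feasibleE th sm sp : th <= 1 ->
  (exists lam, input_feasible X Y o (BccPoint th lam sm sp)) <->
  vle 0 sm /\ slack_pair ((1 - th) *: x + sm) sp.
Proof.
move=> th1; split.
  move=> [lam [/= hX hY lam1 lam0 [sm0 sp0]]]; split=> //; split=> //.
    apply/vle0P => i; rewrite 2!mxE addr_ge0 ?mulr_ge0 ?subr_ge0 //.
    by move/vle0P: sm0.
  exists lam; split=> // i; have := hX i; rewrite !mxE; lra.
move=> [sm0 [_ sp0 [lam [lam0 lam1 hX hY]]]]; exists lam; split=> //= i.
have := hX i; rewrite !mxE; lra.
Qed.

(** Expanding the outputs by [phi] amounts to an additional output slack [(phi - 1) *: y]. *)
Lemma output_feasibleE phi sm sp : 1 <= phi ->
  (exists lam, output_feasible X Y o (BccPoint phi lam sm sp)) <->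
  vle 0 sp /\ slack_pair sm ((phi - 1) *: y + sp).
Proof.
move=> phi1; split.
  move=> [lam [/= hX hY lam1 lam0 [sm0 sp0]]]; split=> //; split=> //.
    apply/vle0P => i; rewrite 2!mxE addr_ge0 ?mulr_ge0 ?subr_ge0 //.
    by move/vle0P: sp0.
  exists lam; split=> // i; have := hY i; rewrite !mxE; lra.
move=> [sp0 [sm0 _ [lam [lam0 lam1 hX hY]]]]; exists lam; split=> //= i.
have := hY i; rewrite !mxE; lra.
Qed.

Lemma slack_input_feasible sm sp : slack_pair sm sp ->
  exists lam, input_feasible X Y o (BccPoint 1 lam sm sp).
Proof.
move=> h; apply/input_feasibleE => //; rewrite subrr scale0r add0r.
by split=> //; case: h.
Qed.

Lemma slack_output_feasible sm sp : slack_pair sm sp ->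
  exists lam, output_feasible X Y o (BccPoint 1 lam sm sp).
Proof.
move=> h; apply/output_feasibleE => //; rewrite subrr scale0r add0r.
by split=> //; case: h.
Qed.

Lemma input_feasible_slack z : input_feasible X Y o z -> Defs.factor z <= 1 ->
  slack_pair ((1 - Defs.factor z) *: x + input_slack z) (output_slack z).
Proof.
case: z => th lam sm sp /= hz th1.
by have [|//] := (input_feasibleE th sm sp th1).1; exists lam.
Qed.

Lemma output_feasible_slack z : output_feasible X Y o z -> 1 <= Defs.factor z ->
  slack_pair (input_slack z) ((Defs.factor z - 1) *: y + output_slack z).
Proof.
case: z => phi lam sm sp /= hz phi1.
by have [|//] := (output_feasibleE phi sm sp phi1).1; exists lam.
Qed.

(** The unit compared with itself, with zero slacks, is feasible at factor one. *)
Lemma input_optimal_le1 z : input_optimal X Y o z -> Defs.factor z <= 1.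
Proof.
move=> [_ h _]; have [lam hl] := slack_input_feasible _ _ slack_pair0.
exact: h hl.
Qed.

Lemma output_optimal_ge1 z : output_optimal X Y o z -> 1 <= Defs.factor z.
Proof.
move=> [_ h _]; have [lam hl] := slack_output_feasible _ _ slack_pair0.
exact: h hl.
Qed.

(** With [x = 0] the factor drops out of the constraints and can be lowered without end. *)
Lemma input_solvable_neq0 : input_solvable X Y o -> x <> 0.
Proof.
move=> [[th lam sm sp] [[hX hY lam1 lam0 s0] h _]] e.
suff /h : input_feasible X Y o (BccPoint (th - 1) lam sm sp).
  by move=> /= le_th; lra.
by split=> //; move: hX; rewrite /= -/x e !scaler0.
Qed.

Lemma output_solvable_neq0 : output_solvable X Y o -> y <> 0.
Proof.
move=> [[phi lam sm sp] [[hX hY lam1 lam0 s0] h _]] e.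
suff /h : output_feasible X Y o (BccPoint (phi + 1) lam sm sp).
  by move=> /= le_phi; lra.
by split=> //; move: hY; rewrite /= -/y e !scaler0.
Qed.

Lemma weakly_efficient_IP : input_solvable X Y o ->
  weakly_efficient_I X Y o <-> ~ inefficient_I X Y o.
Proof.
move=> [z hz]; split=> [[z1 [h1 e1]] [z2 [h2 e2]] | h].
  by case: h1 h2 => _ h1 _ [f2 _ _]; have := h1 _ f2; lra.
exists z; split=> //; apply/le_anti; rewrite input_optimal_le1 //= leNgt.
by apply/negP => lt1; apply: h; exists z.
Qed.

Lemma weakly_efficient_OP : output_solvable X Y o ->
  weakly_efficient_O X Y o <-> ~ inefficient_O X Y o.
Proof.
move=> [z hz]; split=> [[z1 [h1 e1]] [z2 [h2 e2]] | h].
  by case: h1 h2 => _ h1 _ [f2 _ _]; have := h1 _ f2; lra.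
exists z; split=> //; apply/le_anti; rewrite output_optimal_ge1 // andbT leNgt.
by apply/negP => lt1; apply: h; exists z.
Qed.

Lemma inefficient_IP : input_solvable X Y o ->
  inefficient_I X Y o <->
  exists sm sp, Omega_bar X Y o (shifted X Y o sm sp) /\ npos sm = npos x.
Proof.
move=> sol; split.
  move=> [z [[hz _ _] th1]]; have hs := input_feasible_slack _ hz (ltW th1).
  set sm := (_ + _) in hs.
  have pos i : 0 < x i 0 -> 0 < sm i 0.
    move=> xi; have [_ _ _ _ [/vle0P/(_ i) s0 _]] := hz.
    by rewrite 2!mxE ltr_wpDr // mulr_gt0 // subr_gt0.
  exists sm, (output_slack z); split; last first.
    apply/eqP; rewrite eqn_leq !npos_le // => i.
    exact: slack_pair_npos hs.
  (* A zero slack would, by [pos], force [x = 0], against solvability. *)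
  apply/Omega_bar_shifted; split=> // -[e _].
  apply: (input_solvable_neq0 sol); apply: vle_anti0 => [|i].
    exact/vle0P.
  by rewrite leNgt; apply/negP => /pos; rewrite e mxE ltxx.
move=> [sm [sp [/Omega_bar_shifted [hs _] en]]]; have [sm0 sp0 _] := hs.
have pos := npos_eq _ _ (fun i => slack_pair_npos sm sp i hs) en.
have [|e e0 he] := scale_below _ _ sm0 _ pos; first exact/vle0P.
(* The part [e *: x] of the slack is traded for a contraction by [1 - e], so the optimal factor lies
   below one. *)
have [_ /(_ _)[]] := input_feasibleE (1 - e) (sm - e *: x) sp ltac:(lra).
  split; first by apply/vle0P => i; have := he i; rewrite !mxE; lra.
  by rewrite subKr addrC subrK.
move=> lam hl; case: sol => z hz; exists z; split=> //.
by have [_ /(_ _ hl) /= hle _] := hz; lra.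
Qed.

Lemma inefficient_O_npos : output_solvable X Y o -> inefficient_O X Y o ->
  exists sm sp, Omega_bar X Y o (shifted X Y o sm sp) /\ npos sp = npos y.
Proof.
move=> sol [z [[hz _ _] phi1]].
have [sm0 sp0 [lam [lam0 lam1 hX hY]]] := output_feasible_slack _ hz (ltW phi1).
(* The optimal output slack is dropped: it may be positive where [y] vanishes. *)
pose sp := (Defs.factor z - 1) *: y; exists (input_slack z), sp.
have d0 : 0 < Defs.factor z - 1 by rewrite subr_gt0.
split; last by apply: eq_card => i; rewrite !inE [fun_of_matrix sp i 0]mxE pmulr_rgt0.
apply/Omega_bar_shifted; split.
  split=> //.
    by apply/vle0P => i; rewrite mxE mulr_ge0 // ltW.
  exists lam; split=> // i; have := hY i.
  have [_ _ _ _ [_ /vle0P/(_ i)]] := hz; rewrite !mxE; lra.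
(* As the factor exceeds one, [sp = 0] would mean [y = 0], against solvability. *)
move=> [_ /eqP]; rewrite scaler_eq0 gt_eqF //= => /eqP.
exact: output_solvable_neq0.
Qed.

(** Equal counts alone do not make the supports of [sp] and [y] agree. Positivity of [y] makes the
    common count [s], so [sp] is positive everywhere and dominates some [e *: y] with [e > 0]. *)
Lemma npos_inefficient_O sm sp : output_solvable X Y o -> vlt 0 y ->
  Omega_bar X Y o (shifted X Y o sm sp) -> npos sp = npos y ->
  inefficient_O X Y o.
Proof.
move=> sol y_gt0 /Omega_bar_shifted [hs _] en; have [sm0 sp0 _] := hs.
have /npos_full pos : npos sp = s by rewrite en; apply/npos_full.
have [||e e0 he] := scale_below _ y sp0; first exact/vle0P.
  by move=> i _; have := pos i; rewrite mxE.
have [_ /(_ _)[]] := output_feasibleE (1 + e) sm (sp - e *: y) ltac:(lra).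
  split; first by apply/vle0P => i; have := he i; rewrite !mxE; lra.
  by rewrite [1 + e]addrC addrK addrC subrK.
move=> lam hl; case: sol => z hz; exists z; split=> //.
by have [_ /(_ _ hl) /= hle _] := hz; lra.
Qed.

Lemma slack_pair_sum0 sm sp : slack_pair sm sp -> vsum sm + vsum sp <= 0 ->
  sm = 0 /\ sp = 0.
Proof.
move=> [sm0 sp0 _] h.
have := vsum_ge0 _ sm0; have := vsum_ge0 _ sp0 => h1 h2.
by split; apply: vsum_eq0 => //; lra.
Qed.

Lemma vsum0 d : vsum (0 : 'cV[R]_d) = 0.
Proof. by rewrite /vsum big1 // => i _; rewrite mxE. Qed.

(** Every slack pair is feasible at factor one, so a second-stage optimum of zero kills them all.
    Conversely, if only the zero pair exists, inefficiency is impossible, and the slacks of an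
    optimum at factor one form such a pair. *)
Lemma strongly_efficient_IP : input_solvable X Y o ->
  strongly_efficient_I X Y o <-> Omega_bar X Y o = set0.
Proof.
move=> sol; split.
  move=> [z [[hz _ hmax] th1 ez1 ez2]]; apply/Omega_bar0P => sm sp hs.
  have [lam hl] := slack_input_feasible _ _ hs.
  apply: slack_pair_sum0 => //; have := hmax _ hl.
  by rewrite /total_slack ez1 ez2 /= !vsum0 addr0; apply.
move=> e; have [|z [hz th1]] := (weakly_efficient_IP sol).2.
  move=> /(inefficient_IP sol) [sm [sp [+ _]]].
  by rewrite e.
exists z; have [fz _ _] := hz.
have := input_feasible_slack _ fz; rewrite th1 subrr scale0r add0r => /(_ (lexx _)).
by move/Omega_bar0P : e => /[apply] -[].
Qed.

Lemma strongly_efficient_OP : output_solvable X Y o ->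
  strongly_efficient_O X Y o <-> Omega_bar X Y o = set0.
Proof.
move=> sol; split.
  move=> [z [[hz _ hmax] th1 ez1 ez2]]; apply/Omega_bar0P => sm sp hs.
  have [lam hl] := slack_output_feasible _ _ hs.
  apply: slack_pair_sum0 => //; have := hmax _ hl.
  by rewrite /total_slack ez1 ez2 /= !vsum0 addr0; apply.
move=> e; have [|z [hz th1]] := (weakly_efficient_OP sol).2.
  move=> /(inefficient_O_npos sol) [sm [sp [+ _]]].
  by rewrite e.
exists z; have [fz _ _] := hz.
have := output_feasible_slack _ fz; rewrite th1 subrr scale0r add0r => /(_ (lexx _)).
by move/Omega_bar0P : e => /[apply] -[].
Qed.

(** * Pareto dominance in terms of slack pairs *)

Lemma TDEA_slackE sm sp : vle 0 sm -> vle 0 sp ->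
  TDEA X Y (x - sm, y + sp) <-> slack_pair sm sp.
Proof.
move=> sm0 sp0; split=> [[_ _ [lam [hX hY lam1 lam0]]] | ].
  split=> //; exists lam; split=> // i.
    by have := hX i; rewrite !mxE; lra.
  by have := hY i; rewrite !mxE; lra.
move=> [_ _ [lam [lam0 lam1 hX hY]]]; split.
(* The shifted inputs stay nonnegative because they lie above [X *m lam]. *)
- apply/vle0P => i /=; have := hX i; have := Xlam_ge0 _ i lam0; rewrite !mxE; lra.
- apply/vle0P => i; rewrite mxE addr_ge0 //.
  by move/vle0P: sp0.
exists lam; split=> // i /=.
  by have := hX i; rewrite !mxE; lra.
by have := hY i; rewrite !mxE; lra.
Qed.

Lemma col_mx_entries {p q} (u : 'cV[R]_p) (v : 'cV[R]_q) (P : R -> Prop) :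
  (forall k, P (col_mx u v k 0)) <->
  (forall i, P (u i 0)) /\ (forall j, P (v j 0)).
Proof.
split=> [h | [hu hv] k].
  split=> i; first by have := h (lshift _ i); rewrite col_mxEu.
  by have := h (rshift _ i); rewrite col_mxEd.
by case: (split_ordP k) => i ->; rewrite ?col_mxEu ?col_mxEd.
Qed.

Lemma dominatesE sm sp :
  dominates (x - sm, y + sp) (x, y) <->
  [/\ vle 0 sm, vle 0 sp & ~ (sm = 0 /\ sp = 0)].
Proof.
rewrite /dominates /=.
have -> : vle (col_mx (- x) y) (col_mx (- (x - sm)) (y + sp)) <->
    vle 0 sm /\ vle 0 sp.
  rewrite !vle0P -(col_mx_entries sm sp (fun a => 0 <= a)).
  rewrite opprB -[sm - x]addrC -add_col_mx.
  by split=> h k; have := h k; rewrite [fun_of_matrix (_ + _) k 0]mxE; lra.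
split=> [[[sm0 sp0] ne] | [sm0 sp0 ne]]; split=> //.
  by move=> [e1 e2]; apply: ne; rewrite e1 e2 subr0 addr0.
move=> /eq_col_mx [/oppr_inj e1 e2]; apply: ne; split.
  by apply: oppr_inj; apply: (addrI x); rewrite e1 oppr0 addr0.
by apply: (addrI y); rewrite e2 addr0.
Qed.

Lemma strongly_dominatesE sm sp :
  strongly_dominates (x - sm, y + sp) (x, y) <-> vlt 0 sm /\ vlt 0 sp.
Proof.
have vlt0P d (v : 'cV[R]_d) : vlt 0 v <-> forall i, 0 < v i 0.
  by split=> h i; have := h i; rewrite mxE.
rewrite /strongly_dominates /= !vlt0P -(col_mx_entries sm sp (fun a => 0 < a)).
rewrite opprB -[sm - x]addrC -add_col_mx.
by split=> h k; have := h k; rewrite [fun_of_matrix (_ + _) k 0]mxE; lra.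
Qed.

(** Writes an arbitrary activity as a shift of the unit, so that the characterisations by slacks
    apply to it. *)
Lemma activity_slack (a : 'cV[R]_m * 'cV[R]_s) :
  a = (x - (x - a.1), y + (a.2 - y)).
Proof. by case: a => a1 a2 /=; rewrite opprB addrC subrK addrC subrK. Qed.

Lemma strongly_efficient_PP :
  strongly_efficient_P X Y o <-> Omega_bar X Y o = set0.
Proof.
rewrite Omega_bar0P; split=> [h sm sp hs | h [a [+ +]]].
  apply: contrapT => ne; apply: h; exists (x - sm, y + sp).
  by have [sm0 sp0 _] := hs; split; [apply/TDEA_slackE | apply/dominatesE].
rewrite {1 2}(activity_slack a) => ta /dominatesE [sm0 sp0].
by apply; apply: h; apply/TDEA_slackE.
Qed.

(** Each count is at most its own dimension, so neither can fall short. *)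
Lemma npos_fullD sm sp : (npos (sm : 'cV[R]_m) + npos (sp : 'cV[R]_s) = m + s)%N ->
  vlt 0 sm /\ vlt 0 sp.
Proof.
move=> e; have := npos_max sm; have := npos_max sp.
by split; apply/npos_full; lia.
Qed.

Lemma inefficient_PP : (0 < m)%N ->
  inefficient_P X Y o <->
  exists sm sp, Omega_bar X Y o (shifted X Y o sm sp) /\
    (npos sm + npos sp = m + s)%N.
Proof.
move=> m_gt0; split=> [[a [+ +]] | [sm [sp [/Omega_bar_shifted [hs _]]]]].
  rewrite {1 2}(activity_slack a) => ta /strongly_dominatesE [smp spp].
  exists (x - a.1), (a.2 - y); split; last by rewrite !(npos_full _).2.
  apply/Omega_bar_shifted; split.
    by apply/TDEA_slackE => // i; apply: ltW; [exact: smp | exact: spp].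
  (* An actual input coordinate is needed for strict positivity to contradict [sm = 0]. *)
  by move=> [e _]; have := smp (Ordinal m_gt0); rewrite e ltxx.
move=> /npos_fullD pos; exists (x - sm, y + sp); have [sm0 sp0 _] := hs.
by split; [apply/TDEA_slackE | apply/strongly_dominatesE].
Qed.

Lemma strongly_efficientP k : meaningful X Y k o ->
  strongly_efficient X Y k o <-> Omega_bar X Y o = set0.
Proof.
case: k => [||_]; [exact: strongly_efficient_IP|exact: strongly_efficient_OP|].
exact: strongly_efficient_PP.
Qed.

End Slacks.

(** * The classification of the units *)

Theorem proposition3p1 (R : realType) (m s n : nat)
    (X : 'M[R]_(m, n)) (Y : 'M[R]_(s, n)) (o : 'I_n)
    (m_gt0 : (0 < m)%N) (s_gt0 : (0 < s)%N)
    (X_ge0 : forall i j, 0 <= X i j) (Y_ge0 : forall r j, 0 <= Y r j) :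
  (* (i) *)
  (forall k : sense, meaningful X Y k o ->
    (E X Y k o <-> Omega X Y o = set0)) /\
  (* (ii) *)
  (forall k : sense, meaningful X Y k o ->
    (E' X Y k o <-> Omega X Y o !=set0 /\ Omega_bar X Y o = set0)) /\
  (* (iii) *)
  (input_solvable X Y o ->
    (WE_I X Y o <->
      Omega_bar X Y o !=set0 /\
      forall sm sp, Omega_bar X Y o (shifted X Y o sm sp) ->
        (npos sm < npos (col o X))%N)) /\
  (* (iv) *)
  (input_solvable X Y o ->
    (NE_I X Y o <->
      Omega_bar X Y o !=set0 /\
      exists sm sp, Omega_bar X Y o (shifted X Y o sm sp) /\
        npos sm = npos (col o X))) /\
  (* (v): the left-to-right direction fails if y_o has a zero entry *)
  (output_solvable X Y o ->
    (vlt 0 (col o Y) -> WE_O X Y o ->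
      Omega_bar X Y o !=set0 /\
      forall sm sp, Omega_bar X Y o (shifted X Y o sm sp) ->
        (npos sp < npos (col o Y))%N) /\
    (Omega_bar X Y o !=set0 /\
      (forall sm sp, Omega_bar X Y o (shifted X Y o sm sp) ->
        (npos sp < npos (col o Y))%N) ->
      WE_O X Y o)) /\
  (* (vi): the right-to-left direction fails if y_o has a zero entry *)
  (output_solvable X Y o ->
    (NE_O X Y o ->
      Omega_bar X Y o !=set0 /\
      exists sm sp, Omega_bar X Y o (shifted X Y o sm sp) /\
        npos sp = npos (col o Y)) /\
    (vlt 0 (col o Y) ->
      Omega_bar X Y o !=set0 /\
      (exists sm sp, Omega_bar X Y o (shifted X Y o sm sp) /\
        npos sp = npos (col o Y)) ->
      NE_O X Y o)) /\
  (* (vii) *)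
  (WE_P X Y o <->
    Omega_bar X Y o !=set0 /\
    forall sm sp, Omega_bar X Y o (shifted X Y o sm sp) ->
      (npos sm + npos sp < m + s)%N) /\
  (* (viii) *)
  (NE_P X Y o <->
    Omega_bar X Y o !=set0 /\
    exists sm sp, Omega_bar X Y o (shifted X Y o sm sp) /\
      (npos sm + npos sp = m + s)%N).
Proof.
have bar_sub : Omega X Y o = set0 -> Omega_bar X Y o = set0.
  by rewrite /Omega_bar => ->; rewrite set0D.
have npos_sm sm sp : Omega_bar X Y o (shifted X Y o sm sp) ->
    (npos sm <= npos (col o X))%N.
  move=> /Omega_bar_shifted [hs _]; apply: npos_le => i.
  exact: slack_pair_npos hs.
split; [|split; [|split; [|split; [|split; [|split; [|split]]]]]].
- move=> k hk; rewrite /E /= strongly_efficientP //.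
  split=> [[e nc] | e].
    (* With [Omega_bar] empty, a point of [Omega] would make the unit a combination of the
       others. *)
    apply/eqP/negPn/negP => /set0P; move: nc; apply: contra_not.
    exact: Omega_combination_of_others.
  split; first exact: bar_sub.
  by move=> /combination_of_others_Omega; rewrite e => -[].
- move=> k hk; rewrite /E' /= strongly_efficientP //.
  split=> [[e /combination_of_others_Omega //] | [ne e]]; split=> //.
  exact: Omega_combination_of_others.
- move=> sol; rewrite /WE_I /= weakly_efficient_IP // strongly_efficient_IP //.
  rewrite inefficient_IP //; split=> [[hn /eqP/set0P ne] | [ne h]].
    (* The count never exceeds that of [x_o], so strict inequality is the negation of the equality
       that characterises inefficiency. *)
    split=> // sm sp hb; rewrite ltn_neqAle (npos_sm _ _ hb) andbT.
    by apply/eqP => e; apply: hn; exists sm, sp.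
  split; last by apply/eqP/set0P.
  by move=> [sm [sp [/h + e]]]; rewrite e ltnn.
- move=> sol; rewrite /NE_I /= inefficient_IP //; split=> [|[]//].
  by move=> ex; split=> //; have [sm [sp [/Omega_barN0]]] := ex.
- move=> sol; rewrite /WE_O /= weakly_efficient_OP // strongly_efficient_OP //.
  split=> [y_gt0 [hn /eqP/set0P ne] | [ne h]].
    split=> // sm sp hb; rewrite ltnNge; apply/negP => le_npos; apply: hn.
    apply: npos_inefficient_O hb _ => //; apply/eqP.
    (* For outputs the upper bound on the count comes from [npos (col o Y) = s], that is, from the
       positivity of [y_o]. *)
    by rewrite eqn_leq le_npos andbT ((npos_full _).2 y_gt0) npos_max.
  split; last by apply/eqP/set0P.
  by move=> /(inefficient_O_npos Y_ge0 sol) [sm [sp [/h + e]]]; rewrite e ltnn.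
- move=> sol; split=> [|y_gt0 [_ [sm [sp [hb e]]]]].
    move=> /(inefficient_O_npos Y_ge0 sol) [sm [sp hb]].
    by split; [case: hb => /Omega_barN0 | exists sm, sp].
  exact: npos_inefficient_O hb e.
- rewrite /WE_P /= strongly_efficient_PP //.
  have -> : weakly_efficient_P X Y o <-> ~ inefficient_P X Y o by [].
  rewrite inefficient_PP //; split=> [[hn /eqP/set0P ne] | [ne h]].
    split=> // sm sp hb; rewrite ltn_neqAle leq_add ?npos_max // andbT.
    by apply/eqP => e; apply: hn; exists sm, sp.
  split; last by apply/eqP/set0P.
  by move=> [sm [sp [/h + e]]]; rewrite e ltnn.
- rewrite /NE_P /= inefficient_PP //; split=> [|[]//].
  by move=> ex; split=> //; have [sm [sp [/Omega_barN0]]] := ex.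
Qed.
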